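(* Let $(p_{ij}\colon(X_j,\nu_j)\to(X_i,\nu_i))_{i\sqsubseteq j\in I}$ be a projective system of valued spaces, and let $X,(p_i)_{i\in I}$ be a projective limit, in the category of topological spaces, of the underlying projective system $(p_{ij}\colon X_j\to X_i)_{i\sqsubseteq j\in I}$. If the family $(\nu_i)_{i\in I}$ is uniformly tight, then there is a unique continuous valuation $\nu$ on $X$ such that $\nu_i=p_i[\nu]$ for every $i\in I$. Moreover, $\nu$ is tight.
   Context: For a topological space $X$, $\mathcal O X$ is its lattice of open subsets, and $\overline{\mathbb R}_+=[0,\infty]$. A valuation on $X$ is a map $\nu\colon\mathcal O X\to\overline{\mathbb R}_+$ with $\nu(\emptyset)=0$, $U\subseteq V\Rightarrow\nu(U)\le\nu(V)$, and $\nu(U\cup V)+\nu(U\cap V)=\nu(U)+\nu(V)$. It is continuous if it preserves suprema of directed families of open sets. For $f\colon X\to Y$ continuous, $f[\nu](V)=\nu(f^{-1}(V))$ for $V\in\mathcal O Y$. A projective system of valued spaces $(p_{ij}\colon(X_j,\nu_j)\to(X_i,\nu_i))_{i\sqsubseteq j\in I}$ consists of a directed preordered set $(I,\sqsubseteq)$, topological spaces $X_i$ with continuous valuations $\nu_i$ ($i\in I$), and continuous maps $p_{ij}\colon X_j\to X_i$ for $i\sqsubseteq j$, with $p_{ii}=\mathrm{id}$, $p_{ij}\circ p_{jk}=p_{ik}$ for $i\sqsubseteq j\sqsubseteq k$, and $p_{ij}[\nu_j]=\nu_i$ for $i\sqsubseteq j$. A projective limit of the underlying system of spaces is its limit in the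 category of topological spaces; up to isomorphism it is the subspace $\{\vec x\in\prod_i X_i\mid x_i=p_{ij}(x_j)\ \forall i\sqsubseteq j\}$ of the product, with $p_i(\vec x)=x_i$. The specialization preordering is $x\le y$ iff every open set containing $x$ contains $y$; $\mathop{\uparrow}A$ is the upward closure of $A$; a set is saturated iff it is an intersection of open sets (equivalently, upwards closed). Compactness does not include Hausdorffness. For a map $\nu\colon\mathcal O X\to\overline{\mathbb R}_+$ and $Q\subseteq X$ compact saturated, $\nu^\bullet(Q)=\inf\{\nu(U)\mid U \text{ open},\,Q\subseteq U\}$. For $r,s\in\overline{\mathbb R}_+$, $r\ll s$ iff $r=0$ or $r<s$. The map $\nu$ is tight if for every open $U$ and every $r\ll\nu(U)$ there is a compact saturated $Q\subseteq U$ with $r\le\nu^\bullet(Q)$. The family $(\nu_i)_{i\in I}$ is uniformly tight if for every $i\in I$, every open $U\subseteq X_i$ and every $r\ll\nu_i(U)$, there is a compact saturated subset $Q$ of $X$ such that $\mathop{\uparrow}p_i[Q]\subseteq U$ and, for every $j\in I$, $r\le\nu_j^\bullet(\mathop{\uparrow}p_j[Q])$. (Here $\mathop{\uparrow}p_j[Q]$ is the upward closure of the image $p_j[Q]$ in $X_j$, which is compact saturated.) *)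

(* Defs.v *)
From mathcomp Require Import all_boot all_order all_algebra.
From mathcomp Require Import all_classical all_reals all_analysis.

Set Implicit Arguments.
Unset Strict Implicit.
Unset Printing Implicit Defensive.
Import Order.TTheory GRing.Theory Num.Theory.
Local Open Scope classical_set_scope.
Local Open Scope ereal_scope.

(* A map from the lattice of open subsets of X to [0, +oo] is encoded as a
   function nu : set X -> \bar R of which only the values on open sets matter:
   all properties below quantify over open sets only, and two such maps denote
   the same one when they agree on open sets (eq_opens). *)

Definition eq_opens {R : realType} {X : topologicalType}
    (mu nu : set X -> \bar R) : Prop :=
  forall U : set X, open U -> mu U = nu U.

Record valuation {R : realType} {X : topologicalType}
    (nu : set X -> \bar R) : Prop := Valuation {
  valuation_ge0 : forall U : set X, open U -> 0 <= nu U;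
  valuation_set0 : nu set0 = 0;
  valuation_le : forall U V : set X,
    open U -> open V -> U `<=` V -> nu U <= nu V;
  valuation_modular : forall U V : set X,
    open U -> open V -> nu (U `|` V) + nu (U `&` V) = nu U + nu V }.

Definition directed_family {X : Type} (D : set (set X)) : Prop :=
  D !=set0 /\
  forall U V, D U -> D V -> exists2 W, D W & U `<=` W /\ V `<=` W.

Definition continuous_valuation {R : realType} {X : topologicalType}
    (nu : set X -> \bar R) : Prop :=
  valuation nu /\
  forall D : set (set X), D `<=` open -> directed_family D ->
    nu (\bigcup_(U in D) U) = ereal_sup [set nu U | U in D].

Definition pushforward_valuation {R : realType} {X Y : topologicalType}
    (f : X -> Y) (nu : set X -> \bar R) : set Y -> \bar R :=
  fun V => nu (f @^-1` V).

Definition specialization {X : topologicalType} (x y : X) : Prop :=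
  forall U : set X, open U -> U x -> U y.

Definition upclosure {X : topologicalType} (A : set X) : set X :=
  [set y | exists2 x, A x & specialization x y].

Definition saturated {X : topologicalType} (A : set X) : Prop :=
  exists2 D : set (set X), D `<=` open & A = \bigcap_(U in D) U.

(* The library's compact does not include the Hausdorff property. *)
Definition compact_saturated {X : topologicalType} (Q : set X) : Prop :=
  compact Q /\ saturated Q.

Definition bullet {R : realType} {X : topologicalType}
    (nu : set X -> \bar R) (Q : set X) : \bar R :=
  ereal_inf [set nu U | U in [set U : set X | open U /\ Q `<=` U]].

Definition way_below {R : realType} (r s : \bar R) : Prop :=
  r = 0 \/ r < s.

Definition tight {R : realType} {X : topologicalType}
    (nu : set X -> \bar R) : Prop :=
  forall (U : set X) (r : \bar R), open U -> 0 <= r -> way_below r (nu U) ->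
    exists Q : set X,
      [/\ compact_saturated Q, Q `<=` U & r <= bullet nu Q].

(* The empty preordered set is not directed. *)
Record directed_preorder {I : Type} (le : I -> I -> Prop) : Prop :=
  DirectedPreorder {
  directed_inhabited : inhabited I;
  directed_refl : forall i, le i i;
  directed_trans : forall i j k, le i j -> le j k -> le i k;
  directed_ub : forall i j, exists2 k, le i k & le j k }.

(* The map p_ij is p i j h for h : le i j. The law for p_ij o p_jk = p_ik is
   stated for every proof of le i k, so no p_ij depends on the choice of h. *)
Record projective_system {I : Type} (le : I -> I -> Prop)
    (X : I -> topologicalType)
    (p : forall i j, le i j -> X j -> X i) : Prop := ProjectiveSystem {
  projsys_directed : directed_preorder le;
  projsys_continuous : forall i j (h : le i j), continuous (p i j h);
  projsys_id : forall i (h : le i i) (x : X i), p i i h x = x;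
  projsys_comp : forall i j k (hij : le i j) (hjk : le j k) (hik : le i k)
    (x : X k), p i j hij (p j k hjk x) = p i k hik x }.

Record projective_valued_system {R : realType} {I : Type}
    (le : I -> I -> Prop) (X : I -> topologicalType)
    (nu : forall i, set (X i) -> \bar R)
    (p : forall i j, le i j -> X j -> X i) : Prop := ProjectiveValuedSystem {
  projvsys_spaces : projective_system p;
  projvsys_valuation : forall i, continuous_valuation (nu i);
  projvsys_push : forall i j (h : le i j),
    eq_opens (pushforward_valuation (p i j h) (nu j)) (nu i) }.

Definition cone {I : Type} (le : I -> I -> Prop) (X : I -> topologicalType)
    (p : forall i j, le i j -> X j -> X i)
    (Y : topologicalType) (q : forall i, Y -> X i) : Prop :=
  (forall i, continuous (q i)) /\
  (forall i j (h : le i j) (y : Y), p i j h (q j y) = q i y).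

Definition projective_limit {I : Type} (le : I -> I -> Prop)
    (Xi : I -> topologicalType) (pij : forall i j, le i j -> Xi j -> Xi i)
    (X : topologicalType) (p : forall i, X -> Xi i) : Prop :=
  cone pij p /\
  forall (Y : topologicalType) (q : forall i, Y -> Xi i), cone pij q ->
    exists! f : Y -> X, continuous f /\ (forall i y, p i (f y) = q i y).

Definition uniformly_tight {R : realType} {I : Type}
    (Xi : I -> topologicalType) (nu : forall i, set (Xi i) -> \bar R)
    (X : topologicalType) (p : forall i, X -> Xi i) : Prop :=
  forall (i : I) (U : set (Xi i)) (r : \bar R),
    open U -> 0 <= r -> way_below r (nu i U) ->
    exists Q : set X,
      [/\ compact_saturated Q,
          upclosure (p i @` Q) `<=` U &
          forall j, r <= bullet (nu j) (upclosure (p j @` Q))].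

(* Main.v *)
(** For U open in the limit X, let U_i be the largest open subset of X_i with
    p_i^-1(U_i) included in U. Since the cylinders p_i^-1(V) form a base, U is
    the directed union of the p_i^-1(U_i), so the only candidate is
    nu(U) = sup_i nu_i(U_i). Uniform tightness gives, for every r << nu(U), a
    compact Q inside U with r <= nu_j^bullet(up p_j[Q]) for all j. Conversely,
    if an open W contains such a Q then, by compactness, so does some
    p_j^-1(W_j), hence r <= nu_j(W_j) <= nu(W). The equalities
    nu_i = p_i[nu], continuity and tightness follow; modularity then passes to
    the limit, as U union V is the directed union of the
    p_i^-1(U_i union V_i). *)

From HB Require Import structures.
Require Import Defs.
From mathcomp Require Import all_boot all_order all_algebra.
From mathcomp Require Import all_classical all_reals all_analysis.

(** * Order and addition in the extended reals *)

Section ExtendedReals.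
Import Order.TTheory GRing.Theory Num.Theory.
Local Open Scope classical_set_scope.
Local Open Scope ereal_scope.

Lemma ereal_dense {R : realType} (a b : \bar R) :
  0 <= b -> b < a -> exists2 r, b < r & r < a.
Proof.
case: a b => [a| |] [b| |] //=; rewrite ?lte_fin ?lee_fin => b0 // ba.
- by exists ((b + a) / 2)%:E; rewrite lte_fin midf_lt.
- by exists (b + 1)%:E; rewrite ?ltry // lte_fin ltrDl.
Qed.

(** By density, [b < a] would leave some [r] strictly between them, nonnegative because [b] is.
    Bounds on [a] are thus tested on approximants from below, the form in which uniform tightness
    supplies them. *)
Lemma way_below_le {R : realType} (a b : \bar R) : 0 <= b ->
  (forall r, 0 <= r -> way_below r a -> r <= b) -> a <= b.
Proof.
move=> b0 H; rewrite leNgt; apply/negP => ba.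
have [r br ra] := ereal_dense a b b0 ba.
have := H r (le_trans b0 (ltW br)) (or_intror ra).
by rewrite leNgt br.
Qed.

Lemma ereal_sup_addl_le {R : realType} (A : set (\bar R)) (y c : \bar R) :
  A !=set0 -> (forall x, A x -> 0 <= x) -> 0 <= y ->
  (forall x, A x -> x + y <= c) -> ereal_sup A + y <= c.
Proof.
move=> [x0 Ax0] A0; case: y => [y| |] // y0 H.
- by rewrite -leeBrDr //; apply: ge_ereal_sup => x /H; rewrite -leeBrDr.
(* For [y = +oo] the single member [x0], being nonnegative, already forces [c = +oo]. *)
- have := H _ Ax0; rewrite addey; last by rewrite gt_eqF // (lt_le_trans _ (A0 _ Ax0)).
  by rewrite leye_eq => /eqP ->; rewrite leey.
Qed.

Lemma ereal_sup_add_le {R : realType} (A B : set (\bar R)) (c : \bar R) :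
  A !=set0 -> B !=set0 ->
  (forall x, A x -> 0 <= x) -> (forall y, B y -> 0 <= y) ->
  (forall x y, A x -> B y -> x + y <= c) ->
  ereal_sup A + ereal_sup B <= c.
Proof.
move=> An Bn A0 B0 H; have [y0 By0] := Bn.
apply: ereal_sup_addl_le => //.
  by apply: le_ereal_sup_tmp; exists y0; [|exact: B0].
move=> x Ax; rewrite addeC; apply: ereal_sup_addl_le => // [|y By].
  exact: A0.
by rewrite addeC; apply: H.
Qed.

End ExtendedReals.

(** * Compactness, saturation and largest open subsets *)

Section Topology.
Local Open Scope classical_set_scope.

(* On X itself, HB.pack would pick up the topology that X already has. *)
Definition discarded_topology (X : topologicalType) : Type := X.
HB.instance Definition _ (X : topologicalType) :=
  Choice.copy (discarded_topology X) X.

Lemma compact_directed_cover {X : topologicalType} (Q : set X)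
    (D : set (set X)) :
  compact Q -> D `<=` open -> directed_family D ->
  Q `<=` \bigcup_(U in D) U -> exists2 W, D W & Q `<=` W.
Proof.
move=> /compact_near_coveringP Qc Dop [[U0 DU0] Ddir] QD.
(* The filter generated by the tails of [D] under inclusion; directedness makes it closed under
   intersection. *)
pose F : set_system (set X) :=
  [set P | exists2 W, D W & forall W', D W' -> W `<=` W' -> P W'].
have FF : Filter F.
  split.
  - by exists U0.
  - move=> P1 P2 [W1 D1 H1] [W2 D2 H2].
    have [W DW [W1W W2W]] := Ddir _ _ D1 D2.
    exists W => // W' DW' WW'; split.
    + by apply: H1 => //; apply: subset_trans WW'.
    + by apply: H2 => //; apply: subset_trans WW'.
  - by move=> P1 P2 P12 [W DW H]; exists W => // W' DW' WW'; apply/P12/H.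
have [|W DW H] := Qc _ F (fun W x => W x) FF.
  move=> x /QD [W DW Wx].
  (* The neighbourhood [W] of [x] is paired with the tail above [W]: every [W'] in that tail
     contains all of [W]. *)
  exists (W, [set W' | D W' /\ W `<=` W']); last first.
    by move=> [y W'] /= [Wy [_]]; apply.
  split => /=; last by exists W.
  by apply: open_nbhs_nbhs; split => //; apply: Dop.
by exists W => //; apply: H.
Qed.

Lemma subset_upclosure {X : topologicalType} (A : set X) : A `<=` upclosure A.
Proof. by move=> x Ax; exists x. Qed.

Lemma upclosure_sub_open {X : topologicalType} (A U : set X) :
  open U -> A `<=` U -> upclosure A `<=` U.
Proof. by move=> Uo AU y [x Ax]; apply => //; apply: AU. Qed.

(** The [U_i] of the overview when [f] is [p i]: on open sets, the right adjoint of the preimage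
    map, as [preimage_inner] and [inner_max] express. *)
Definition inner {X Y : topologicalType} (f : X -> Y) (U : set X) : set Y :=
  \bigcup_(V in [set V | open V /\ f @^-1` V `<=` U]) V.

Section Inner.
Context {X Y : topologicalType} (f : X -> Y).

Lemma inner_open (U : set X) : open (inner f U).
Proof. by apply: bigcup_open => V []. Qed.

Lemma preimage_inner (U : set X) : f @^-1` inner f U `<=` U.
Proof. by move=> x [V [_ VU] Vx]; apply: VU. Qed.

Lemma inner_max (U : set X) (V : set Y) :
  open V -> f @^-1` V `<=` U -> V `<=` inner f U.
Proof. by move=> Vo VU x Vx; exists V. Qed.

Lemma inner_le (U V : set X) : U `<=` V -> inner f U `<=` inner f V.
Proof.
move=> UV; apply: inner_max; first exact: inner_open.
exact: subset_trans (@preimage_inner U) UV.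
Qed.

(** Only an inclusion, in contrast to [innerI]: a right adjoint preserves meets, but in general not
    joins. *)
Lemma innerU_sub (U V : set X) :
  inner f U `|` inner f V `<=` inner f (U `|` V).
Proof. by rewrite subUset; split; apply: inner_le => x ?; [left|right]. Qed.

Lemma innerI (U V : set X) : inner f (U `&` V) = inner f U `&` inner f V.
Proof.
apply/seteqP; split.
  by rewrite subsetI; split; apply: inner_le => x [].
apply: inner_max; first by apply: openI; exact: inner_open.
by move=> x [] ? ?; split; apply: preimage_inner.
Qed.

End Inner.
End Topology.

(** * Cylinders in the projective limit *)

Section ProjectiveLimit.
Import Order.TTheory GRing.Theory Num.Theory.
Local Open Scope classical_set_scope.
Local Open Scope ereal_scope.
Context (I : Type) (le : I -> I -> Prop) (Xi : I -> topologicalType)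
  (pij : forall i j, le i j -> Xi j -> Xi i)
  (X : topologicalType) (p : forall i, X -> Xi i).
Hypothesis projsys : projective_system pij.
Hypothesis projlim : projective_limit pij p.

Let p_cont i : continuous (p i). Proof. exact: projlim.1.1. Qed.

Let p_comp i j (h : le i j) x : pij i j h (p j x) = p i x.
Proof. exact: projlim.1.2. Qed.

Let p_open i (V : set (Xi i)) : open V -> open (p i @^-1` V).
Proof. by move=> Vo; apply: open_comp => // x _; apply: p_cont. Qed.

Let pij_open i j (h : le i j) (V : set (Xi i)) :
  open V -> open (pij i j h @^-1` V).
Proof.
by move=> Vo; apply: open_comp => // x _; apply: (projsys_continuous projsys).
Qed.

Let preimage_comp i j (h : le i j) (V : set (Xi i)) :
  p j @^-1` (pij i j h @^-1` V) = p i @^-1` V.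
Proof. by apply/seteqP; split => x /=; rewrite p_comp. Qed.

Let le_ub i j : exists2 k, le i k & le j k.
Proof. exact: directed_ub (projsys_directed projsys) i j. Qed.

(* The identity from X to X with the initial topology of the p_i is
   continuous. The universal property gives a continuous map back, whose
   composite with it is the identity by uniqueness. *)
Lemma projective_limit_base (U : set X) (x : X) : open U -> U x ->
  exists i V, [/\ open V, V (p i x) & p i @^-1` V `<=` U].
Proof.
pose op (W : set X) := forall y, W y ->
  exists i V, [/\ open V, V (p i y) & p i @^-1` V `<=` W].
have opT : op setT.
  have [i] := directed_inhabited (projsys_directed projsys).
  by move=> y _; exists i, setT; split => //; exact: openT.
have opI : setI_closed op.
  move=> A B Ao Bo y [/Ao [i [V [Vo Vy VA]]] /Bo [j [W [Wo Wy WB]]]].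
  have [k ik jk] := le_ub i j.
  exists k, (pij i k ik @^-1` V `&` pij j k jk @^-1` W); split.
  - by apply: openI; apply: pij_open.
  - by split; rewrite /= p_comp.
  - by move=> z [] /=; rewrite !p_comp => Vz Wz; split; [apply: VA|apply: WB].
have op_bigU (K : Type) (f : K -> set X) :
    (forall k, op (f k)) -> op (\bigcup_k f k).
  move=> fo y [k _ /fo [i [V [Vo Vy VA]]]]; exists i, V; split => //.
  by move=> z Vz; exists k => //; apply: VA.
pose top := isOpenTopological.Build (discarded_topology X) opT opI op_bigU.
pose Y : topologicalType := HB.pack (discarded_topology X) top.
pose q i : Y -> Xi i := p i.
have qcone : cone pij q.
  split=> [i|]; last exact: projlim.1.2.
  apply/continuousP => V Vo; change (op (p i @^-1` V)) => y Vy.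
  by exists i, V; split.
have [f [[fc fp] _]] := projlim.2 Y q qcone.
have idYc : continuous (idfun : X -> Y).
  apply/continuousP => W Wop; have Wo : op W := Wop.
  rewrite openE => y /Wo [i [V [Vo Vy VW]]].
  rewrite /interior /= nbhsE; exists (p i @^-1` V) => //; split => //.
  exact: p_open.
have [g [_ guniq]] := projlim.2 X p projlim.1.
have gf : g = f.
  apply: guniq; split => //.
  by move=> y; apply: (@continuous_comp X Y X idfun f); [exact: idYc|exact: fc].
have gid : g = idfun by apply: guniq; split => // y; exact: cvg_id.
move=> Uo; suff : op U by apply.
have -> : U = f @^-1` U by rewrite -gf gid.
by move/continuousP: fc; apply.
Qed.

(** The second condition makes the cylinders over the [A i] grow with the index. It covers both
    families used below, the [U_i] and the unions of [U_i] and [V_i]. *)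
Definition compatible_opens (A : forall i, set (Xi i)) : Prop :=
  (forall i, open (A i)) /\
  (forall i j (h : le i j), pij i j h @^-1` A i `<=` A j).

Definition cylinders (A : forall i, set (Xi i)) : set (set X) :=
  range (fun i => p i @^-1` A i).

Lemma cylinders_open A : compatible_opens A -> cylinders A `<=` open.
Proof. by move=> [Ao _] _ [i _ <-]; apply: p_open. Qed.

Lemma cylinders_directed A : compatible_opens A -> directed_family (cylinders A).
Proof.
move=> [_ Acomp]; have [i0] := directed_inhabited (projsys_directed projsys).
split; first by exists (p i0 @^-1` A i0), i0.
move=> _ _ [i _ <-] [j _ <-]; have [k ik jk] := le_ub i j.
exists (p k @^-1` A k); first by exists k.
split=> x Ax; [apply: (Acomp i k ik)|apply: (Acomp j k jk)];
  by rewrite /= p_comp.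
Qed.

Lemma inner_compatible (U : set X) : compatible_opens (fun i => inner (p i) U).
Proof.
split=> [i|i j h]; first exact: inner_open.
apply: inner_max; first by apply: pij_open; exact: inner_open.
by rewrite preimage_comp; exact: preimage_inner.
Qed.

Lemma bigcup_inner (U : set X) : open U ->
  \bigcup_(W in cylinders (fun i => inner (p i) U)) W = U.
Proof.
move=> Uo; apply/seteqP; split => [x [_ [i _ <-]]|x Ux].
  exact: preimage_inner.
have [i [V [Vo Vx VU]]] := projective_limit_base U x Uo Ux.
exists (p i @^-1` inner (p i) U); first by exists i.
exact: (inner_max (p i) U V).
Qed.

(** * The candidate valuation and its uniqueness *)

Section LimitValuation.
Context (R : realType) (nui : forall i, set (Xi i) -> \bar R).
Hypothesis nui_cont : forall i, continuous_valuation (nui i).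
Hypothesis nui_push : forall i j (h : le i j),
  eq_opens (pushforward_valuation (pij i j h) (nui j)) (nui i).

Definition limit_valuation (U : set X) : \bar R :=
  ereal_sup (range (fun i => nui i (inner (p i) U))).

Local Notation nu := limit_valuation.

Let i_inh : inhabited I.
Proof. exact: directed_inhabited (projsys_directed projsys). Qed.

Let nui_ge0 i (V : set (Xi i)) : open V -> 0 <= nui i V.
Proof. exact: (valuation_ge0 (nui_cont i).1). Qed.

Let nui_le i (V W : set (Xi i)) : open V -> open W -> V `<=` W ->
  nui i V <= nui i W.
Proof. exact: (valuation_le (nui_cont i).1). Qed.

(** Pushing forward gives [nui i (A i)] as the [nui j]-value of a subset of [A j]. Terms taken at
    two indices can therefore be compared at a common upper bound. *)
Lemma compatible_nui_le A i j (h : le i j) : compatible_opens A ->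
  nui i (A i) <= nui j (A j).
Proof.
move=> [Ao Acomp]; rewrite -(nui_push i j h) //.
by apply: nui_le => //; apply: pij_open.
Qed.

Lemma inner_le_limit_valuation i (U : set X) :
  nui i (inner (p i) U) <= nu U.
Proof. by apply: ereal_sup_ubound; exists i. Qed.

Lemma limit_valuation_ge0 (U : set X) : 0 <= nu U.
Proof.
case: i_inh => i; apply: le_trans (inner_le_limit_valuation i U).
by apply: nui_ge0; exact: inner_open.
Qed.

Lemma limit_valuation_le (U V : set X) : U `<=` V -> nu U <= nu V.
Proof.
move=> UV; apply: ge_ereal_sup => _ [i _ <-].
apply: le_trans (inner_le_limit_valuation i V).
by apply: nui_le; [exact: inner_open|exact: inner_open|exact: inner_le].
Qed.

(** Continuity of [mu] along the directed union of [bigcup_inner] determines its value from those on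
    cylinders. *)
Lemma continuous_valuation_limitE (mu : set X -> \bar R) :
  continuous_valuation mu ->
  (forall i, eq_opens (nui i) (pushforward_valuation (p i) mu)) ->
  eq_opens mu nu.
Proof.
move=> [_ mu_sup] mu_push U Uo.
rewrite -{1}(bigcup_inner U Uo) mu_sup; last first.
- exact: cylinders_directed (inner_compatible U).
- exact: cylinders_open (inner_compatible U).
congr ereal_sup; rewrite /cylinders image_comp.
apply: eq_imagel => i _ /=; rewrite (mu_push i) //; exact: inner_open.
Qed.

Lemma bullet_le_limit_valuation (Q W : set X) (r : \bar R) :
  compact Q -> (forall j, r <= bullet (nui j) (upclosure (p j @` Q))) ->
  open W -> Q `<=` W -> r <= nu W.
Proof.
move=> Qc Qr Wo; rewrite -{1}(bigcup_inner W Wo) => QW.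
have [_ [j _ <-] QWj] := compact_directed_cover Q _ Qc
  (cylinders_open _ (inner_compatible W))
  (cylinders_directed _ (inner_compatible W)) QW.
apply: le_trans (inner_le_limit_valuation j W).
(* The open set [inner (p j) W] contains the upward closure of the image of [Q], so it competes in
   the infimum defining [bullet]. *)
apply: le_trans (Qr j) _; apply: ge_ereal_inf.
exists (nui j (inner (p j) W)) => //; exists (inner (p j) W) => //; split.
  exact: inner_open.
apply: upclosure_sub_open; first exact: inner_open.
by move=> _ [x /QWj Wx <-].
Qed.

(** * Consequences of uniform tightness *)

Hypothesis nui_tight : uniformly_tight nui p.

Lemma limit_valuation_approx (U : set X) (r : \bar R) :
  0 <= r -> way_below r (nu U) ->
  exists Q, [/\ compact_saturated Q, Q `<=` U &
    forall j, r <= bullet (nui j) (upclosure (p j @` Q))].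
Proof.
move=> r0 rU.
have [i ri] : exists i, way_below r (nui i (inner (p i) U)).
  (* A positive [r] lies strictly below some term of the supremum; for [r = 0] any index will do. *)
  case: rU => [->|/ereal_sup_gt [_ [i _ <-] ri]]; last by exists i; right.
  by case: i_inh => i; exists i; left.
have [Q [Qcs QU Qr]] := nui_tight i _ r (inner_open _ _) r0 ri.
exists Q; split => // x Qx; apply: (preimage_inner (p i)).
by apply/QU/subset_upclosure; exists x.
Qed.

(** One inequality is maximality of [inner]. For the other, a compact approximant [Q] inside the
    cylinder has its image, with upward closure, inside [V], which bounds [r] by [nui i V]. *)
Lemma limit_valuation_preimage i (V : set (Xi i)) : open V ->
  nu (p i @^-1` V) = nui i V.
Proof.
move=> Vo; apply/eqP; rewrite eq_le; apply/andP; split; last first.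
  apply: le_trans (inner_le_limit_valuation i _).
  by apply: nui_le => //; [exact: inner_open|exact: inner_max].
apply: way_below_le => [|r r0 /(limit_valuation_approx _ _ r0)].
  exact: nui_ge0.
move=> [Q [_ QV Qr]]; apply: le_trans (Qr i) _; apply: ge_ereal_inf.
exists (nui i V) => //; exists V => //; split => //.
by apply: upclosure_sub_open => // _ [x /QV Vx <-].
Qed.

(** A compact approximant inside the directed union already lies in one member of [D], whose value
    bounds [r]. *)
Lemma limit_valuation_bigcup (D : set (set X)) :
  D `<=` open -> directed_family D ->
  nu (\bigcup_(U in D) U) = ereal_sup [set nu U | U in D].
Proof.
move=> Dop Ddir; apply/eqP; rewrite eq_le; apply/andP; split; last first.
  apply: ge_ereal_sup => _ [U DU <-]; apply: limit_valuation_le.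
  exact: bigcup_sup.
have [[U0 DU0] _] := Ddir.
apply: way_below_le => [|r r0 /(limit_valuation_approx _ _ r0)].
  apply: le_ereal_sup_tmp; exists (nu U0); first by exists U0.
  exact: limit_valuation_ge0.
move=> [Q [[Qc _] QD Qr]].
have [W DW QW] := compact_directed_cover Q D Qc Dop Ddir QD.
apply: le_ereal_sup_tmp; exists (nu W); first by exists W.
by apply: bullet_le_limit_valuation QW => //; apply: Dop.
Qed.

(** The supremum may be computed along any compatible family with the given union, not only the
    largest one; modularity needs this for unions. *)
Lemma limit_valuation_cylinders A : compatible_opens A ->
  nu (\bigcup_(W in cylinders A) W) = ereal_sup (range (fun i => nui i (A i))).
Proof.
move=> Acomp; rewrite limit_valuation_bigcup; last first.
- exact: cylinders_directed.
- exact: cylinders_open.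
congr ereal_sup; rewrite /cylinders image_comp.
by apply: eq_imagel => i _ /=; rewrite limit_valuation_preimage //; apply Acomp.1.
Qed.

(** * Modularity *)

Lemma innerU_compatible (U V : set X) :
  compatible_opens (fun i => inner (p i) U `|` inner (p i) V).
Proof.
have [Uo Uc] := inner_compatible U; have [Vo Vc] := inner_compatible V.
split=> [i|i j h x]; first exact: openU.
by move=> [?|?]; [left; apply: (Uc i j h)|right; apply: (Vc i j h)].
Qed.

Lemma bigcup_innerU (U V : set X) : open U -> open V ->
  \bigcup_(W in cylinders (fun i => inner (p i) U `|` inner (p i) V)) W =
  U `|` V.
Proof.
move=> Uo Vo; apply/seteqP; split => [x [_ [i _ <-]]|x].
  by move=> [?|?]; [left|right]; apply: (preimage_inner (p i)).
rewrite -{1}(bigcup_inner U Uo) -{1}(bigcup_inner V Vo).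
by move=> [[_ [i _ <-] Wx]|[_ [i _ <-] Wx]];
  exists (p i @^-1` (inner (p i) U `|` inner (p i) V));
  [exists i|left|exists i|right].
Qed.

Lemma limit_valuation_modular (U V : set X) : open U -> open V ->
  nu (U `|` V) + nu (U `&` V) = nu U + nu V.
Proof.
move=> Uo Vo; case: i_inh => i0.
have modular k : nui k (inner (p k) U `|` inner (p k) V) +
    nui k (inner (p k) U `&` inner (p k) V) =
    nui k (inner (p k) U) + nui k (inner (p k) V).
  by apply: (valuation_modular (nui_cont k).1); exact: inner_open.
have innerUo k : open (inner (p k) U `|` inner (p k) V).
  by apply: openU; exact: inner_open.
apply/eqP; rewrite eq_le; apply/andP; split.
(* Since [inner] need not preserve unions, the value at the union is rewritten as a supremum of
   values at [U_i] union [V_i], where [nui i] is modular. *)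
- rewrite -{1}(bigcup_innerU U V Uo Vo).
  rewrite (limit_valuation_cylinders _ (innerU_compatible U V)).
  apply: ereal_sup_add_le.
  + by eexists; exists i0.
  + by eexists; exists i0.
  + by move=> _ [i _ <-]; apply: nui_ge0.
  + by move=> _ [i _ <-]; apply: nui_ge0; exact: inner_open.
  move=> _ _ [i _ <-] [j _ <-]; have [k ik jk] := le_ub i j.
  apply: (@le_trans _ _ (nui k (inner (p k) U `|` inner (p k) V) +
    nui k (inner (p k) (U `&` V)))).
    apply: leeD.
    - exact: (compatible_nui_le _ i k ik (innerU_compatible U V)).
    - exact: (compatible_nui_le _ j k jk (inner_compatible _)).
  by rewrite innerI modular; apply: leeD; exact: inner_le_limit_valuation.
- apply: ereal_sup_add_le.
  + by eexists; exists i0.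
  + by eexists; exists i0.
  + by move=> _ [i _ <-]; apply: nui_ge0; exact: inner_open.
  + by move=> _ [i _ <-]; apply: nui_ge0; exact: inner_open.
  move=> _ _ [i _ <-] [j _ <-]; have [k ik jk] := le_ub i j.
  apply: (@le_trans _ _ (nui k (inner (p k) U) + nui k (inner (p k) V))).
    apply: leeD.
    - exact: (compatible_nui_le _ i k ik (inner_compatible U)).
    - exact: (compatible_nui_le _ j k jk (inner_compatible V)).
  (* In this direction the inclusion [innerU_sub] suffices. *)
  rewrite -modular -innerI; apply: leeD; last exact: inner_le_limit_valuation.
  apply: le_trans (inner_le_limit_valuation k _).
  by apply: nui_le => //; [exact: inner_open|exact: innerU_sub].
Qed.

Lemma limit_valuation_continuous : continuous_valuation nu.
Proof.
split; last exact: limit_valuation_bigcup.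
split.
- by move=> U _; exact: limit_valuation_ge0.
(* The set [inner (p i) set0] may be nonempty when [p i] is not surjective, so the empty set is
   treated as a cylinder instead. *)
- case: i_inh => i; rewrite -(preimage_set0 (p i)).
  rewrite limit_valuation_preimage ?(valuation_set0 (nui_cont i).1) //.
  exact: open0.
- by move=> U V _ _; exact: limit_valuation_le.
- exact: limit_valuation_modular.
Qed.

Lemma limit_valuation_tight : tight nu.
Proof.
move=> U r Uo r0 /(limit_valuation_approx _ _ r0) [Q [Qcs QU Qr]].
exists Q; split => //; apply: le_ereal_inf_tmp => _ [W [Wo QW] <-].
exact: bullet_le_limit_valuation Qcs.1 Qr Wo QW.
Qed.

End LimitValuation.
End ProjectiveLimit.

(** * Existence, uniqueness and tightness of the limit valuation *)

Theorem theorem6p7 (R : realType) (I : Type) (le : I -> I -> Prop)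
    (Xi : I -> topologicalType) (nui : forall i, set (Xi i) -> \bar R)
    (pij : forall i j, le i j -> Xi j -> Xi i)
    (X : topologicalType) (p : forall i, X -> Xi i) :
  projective_valued_system nui pij ->
  projective_limit pij p ->
  uniformly_tight nui p ->
  exists nu : set X -> \bar R,
    [/\ continuous_valuation nu /\
          (forall i, eq_opens (nui i) (pushforward_valuation (p i) nu)),
        (forall nu' : set X -> \bar R,
          continuous_valuation nu' ->
          (forall i, eq_opens (nui i) (pushforward_valuation (p i) nu')) ->
          eq_opens nu' nu)
      & tight nu].
Proof.
move=> [projsys nui_cont nui_push] projlim nui_tight.
exists (limit_valuation I Xi X p R nui); split.
- split; first by apply: (limit_valuation_continuous I le Xi pij).
  move=> i V Vo; symmetry.
  exact: (limit_valuation_preimage I le Xi pij).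
- exact: (continuous_valuation_limitE I le Xi pij).
- exact: (limit_valuation_tight I le Xi pij).
Qed.
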